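(* Let $d\in\mathbb{N}$ be a constant. There exists a non-adaptive algorithm that, given sample and query access to an unknown distribution $D$ over $\{0,1\}^n$ and parameters $\alpha,\beta\in(0,1)$ with $\beta<\alpha$ and $\varepsilon := 17(3\alpha+\beta/\alpha)<1$, makes a number of queries that depends only on $\alpha,\beta$ and $d$, and outputs either a full description of a distribution over $\{0,1\}^n$ or Fail, such that: (i) If $D$ is $\beta$-close to VC-dimension $d$, then with probability at least $2/3$ the algorithm outputs a distribution $D'$ such that $d_{EM}(D,D'_\sigma)\le\varepsilon$ for some permutation $\sigma:[n]\to[n]$. (ii) For every $D$, the probability that the algorithm outputs a distribution $D'$ with $d_{EM}(D,D'_\sigma)>\varepsilon$ for every permutation $\sigma:[n]\to[n]$ is at most $1/3$. (If $D$ is not $\beta$-close to VC-dimension $d$, the algorithm may output Fail with any probability.)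
   Context: Huge object model: the algorithm gets independent samples from $D$ and may query individual coordinates of samples; the query complexity is the number of coordinates read; non-adaptive means all queried coordinate sets are fixed from the random coins before any answer is seen. $d_H$ is the normalized Hamming distance; $d_{EM}$ is the Earth Mover Distance (minimum over couplings/flows $f$ of $\sum f_{\mathbf{X}\mathbf{Y}}d_H(\mathbf{X},\mathbf{Y})$). For a permutation $\sigma$ of $[n]$, $D_\sigma$ satisfies $D(w_1,\dots,w_n)=D_\sigma(w_{\sigma(1)},\dots,w_{\sigma(n)})$. A set $V\subseteq\{0,1\}^n$ shatters an index sequence $I=(i_1,\dots,i_k)$ if $\{(v_{i_1},\dots,v_{i_k}):v\in V\}=\{0,1\}^k$; the VC-dimension of $V$ is the largest size of a shattered index sequence. A distribution has VC-dimension at most $d$ if its support does; $D$ is $\beta$-close to VC-dimension $d$ if there is $D_0$ of VC-dimension at most $d$ with $d_{EM}(D,D_0)\le\beta$. *)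

(* Defs.v *)
From mathcomp Require Import all_boot all_order fingroup perm all_algebra.
From mathcomp Require Import classical_sets reals.

Set Implicit Arguments.
Unset Strict Implicit.
Unset Printing Implicit Defensive.

Import Order.TTheory GRing.Theory Num.Theory.
Local Open Scope ring_scope.

Notation cube n := {ffun 'I_n -> bool}.

Section Distributions.
Variables (R : realType) (T : finType).

Record dist := Dist {
  pmf :> {ffun T -> R};
  pmf_ge0 : forall x, 0 <= pmf x;
  pmf_sum1 : \sum_x pmf x = 1
}.

Definition supp (D : dist) : {set T} := [set x | 0 < D x].

Definition coupling (D1 D2 : dist) (f : {ffun T * T -> R}) : Prop :=
  [/\ forall p, 0 <= f p,
      forall x, \sum_y f (x, y) = D1 x
    & forall y, \sum_x f (x, y) = D2 y].

End Distributions.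

Section Distances.
Variables (R : realType) (n : nat).

(* When n = 0 this is 0 / 0 = 0. *)
Definition dH (x y : cube n) : R := #|[set i | x i != y i]|%:R / n%:R.

Definition transport_cost (f : {ffun cube n * cube n -> R}) : R :=
  \sum_x \sum_y f (x, y) * dH x y.

(* The couplings form a nonempty compact set on which the cost is continuous,
   so this infimum is a minimum. *)
Definition dEM (D1 D2 : dist R (cube n)) : R :=
  inf [set c | exists2 f, coupling D1 D2 f & c = transport_cost f]%classic.

End Distances.

Section Permutations.
Variables (R : realType) (n : nat).
Implicit Types (D : dist R (cube n)) (s : 'S_n).

Definition permute s (w : cube n) : cube n := [ffun i => w (s i)].

Lemma permuteK s : cancel (permute s) (permute s^-1%g).
Proof. by move=> w; apply/ffunP => i; rewrite !ffunE permKV. Qed.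

Lemma permuteVK s : cancel (permute s^-1%g) (permute s).
Proof. by move=> w; apply/ffunP => i; rewrite !ffunE permK. Qed.

Definition perm_pmf s D : {ffun cube n -> R} := [ffun w => D (permute s^-1%g w)].

Lemma perm_pmf_ge0 s D w : 0 <= perm_pmf s D w.
Proof. by rewrite ffunE pmf_ge0. Qed.

Lemma perm_pmf_sum1 s D : \sum_w perm_pmf s D w = 1.
Proof.
rewrite -(pmf_sum1 D) (reindex (permute s)) /=; last first.
  by exists (permute s^-1%g) => w _; rewrite ?permuteK ?permuteVK.
by apply: eq_bigr => w _; rewrite ffunE permuteK.
Qed.

Definition perm_dist s D : dist R (cube n) :=
  Dist (@perm_pmf_ge0 s D) (perm_pmf_sum1 s D).

Lemma perm_distE s D w : D w = perm_dist s D (permute s w).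
Proof. by rewrite /= ffunE permuteK. Qed.

End Permutations.

Section VCDimension.
Variable n : nat.
Implicit Type V : {set cube n}.

Definition shatters V k (I : k.-tuple 'I_n) : bool :=
  [set [tuple v (tnth I j) | j < k] | v : cube n in V] == [set: k.-tuple bool].

Lemma shatters_inj V k (I : k.-tuple 'I_n) :
  shatters V I -> injective (tnth I).
Proof.
move=> /eqP VI i j Iij; apply/eqP.
have : [tuple l == i | l < k] \in [set: k.-tuple bool] by rewrite inE.
rewrite -VI => /imsetP[v _ vE].
have vEl l : (l == i) = v (tnth I l).
  by move/(congr1 (fun t : k.-tuple bool => tnth t l)): vE; rewrite !tnth_mktuple.
by rewrite eq_sym vEl -Iij -vEl.
Qed.

Lemma shatters_leq V k (I : k.-tuple 'I_n) : shatters V I -> (k <= n)%N.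
Proof.
by move=> /shatters_inj /leq_card; rewrite !card_ord.
Qed.

(* Bounding the length by n loses nothing, by shatters_leq. *)
Definition VCdim V : nat :=
  \max_(k < n.+1 | [exists I : k.-tuple 'I_n, shatters V I]) k.

Lemma shatters_leq_VCdim V k (I : k.-tuple 'I_n) :
  shatters V I -> (k <= VCdim V)%N.
Proof.
move=> VI; have kn : (k < n.+1)%N by rewrite ltnS (shatters_leq VI).
apply: (@leq_bigmax_cond _ _ (fun k : 'I_n.+1 => k : nat) (Ordinal kn)).
by apply/existsP; exists I.
Qed.

End VCDimension.

Definition close_to_VCdim (R : realType) n (beta : R) (d : nat)
    (D : dist R (cube n)) : Prop :=
  exists2 D0 : dist R (cube n), (VCdim (supp D0) <= d)%N & dEM D D0 <= beta.

Section Algorithms.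
Variables (R : realType) (n : nat).

(* The view of s samples: the bits read, and None at unread coordinates. *)
Definition view s := {ffun 'I_s -> {ffun 'I_n -> option bool}}.

Definition read s (Q : {ffun 'I_s -> {set 'I_n}})
    (X : {ffun 'I_s -> cube n}) : view s :=
  [ffun i => [ffun j => if j \in Q i then Some (X i j) else None]].

(* Non-adaptivity: the queried sets are a function of the coins alone, and the
   output sees the samples only through the bits read.  The output None stands
   for Fail. *)
Record nonadaptive := NonAdaptive {
  samples : nat;
  coins : finType;
  coin_dist : dist R coins;
  queries : coins -> {ffun 'I_samples -> {set 'I_n}};
  output : coins -> view samples -> option (dist R (cube n))
}.

Definition query_complexity (A : nonadaptive) : nat :=
  \max_(r : coins A) \sum_(i < samples A) #|queries r i|.

(* The probability, over the coins and the i.i.d. samples from D, that the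
   output satisfies E. *)
Definition prob_output (A : nonadaptive) (D : dist R (cube n))
    (E : pred (option (dist R (cube n)))) : R :=
  \sum_(r : coins A) \sum_(X : {ffun 'I_(samples A) -> cube n}
                          | E (output r (read (queries r) X)))
    coin_dist A r * \prod_(i < samples A) D (X i).

Definition outputs_good (D : dist R (cube n)) (eps : R) :
    pred (option (dist R (cube n))) :=
  fun o => if o is Some D' then [exists s : 'S_n, dEM D (perm_dist s D') <= eps]
           else false.

Definition outputs_bad (D : dist R (cube n)) (eps : R) :
    pred (option (dist R (cube n))) :=
  fun o => if o is Some D' then [forall s : 'S_n, eps < dEM D (perm_dist s D')]
           else false.

End Algorithms.

(* Main.v *)
(* Read [N = s + u] samples on a common random set of [m] coordinates.  Up to a
   permutation of the coordinates, the tuple of samples is described by the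
   frequencies of the [2 ^ N] possible columns, and these are estimated by the
   frequencies among the queried coordinates; so the algorithm recovers the
   samples up to a common permutation and a Hamming error [alpha].  It then
   compares the last [u] samples with the first [s]: if their mean distance to
   the nearest of the first [s] samples is small, the empirical distribution of
   the last [u] is output, otherwise Fail.
   Soundness: given the first [s] samples, Chebyshev's inequality shows that the
   mean distance and the weights of the [s] Voronoi cells are correctly estimated
   by the last [u] samples, and then both [D] and the empirical distribution are
   close to the same distribution on the [s] centres.
   Completeness: by Sauer-Shelah a set of bounded VC-dimension has an [alpha]-net
   of size independent of [n].  The same estimate, with the net as centres, shows
   that the empirical distribution of the first [s] samples is close to [D], so
   that these samples are good centres and the test passes. *)
Require Import Defs.
From mathcomp Require Import all_boot all_order fingroup perm all_algebra.
From mathcomp Require Import classical_sets reals boolp.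
From mathcomp Require Import ring lra zify.

Set Implicit Arguments.
Unset Strict Implicit.
Unset Printing Implicit Defensive.

Import Order.TTheory GRing.Theory Num.Theory.
Local Open Scope ring_scope.

(** * Finite expectations and Chebyshev's inequality *)

Section Expectation.
Variables (R : realType) (T : finType).
Implicit Types (mu : dist R T) (phi psi : T -> R).

Definition Ex mu phi : R := \sum_x mu x * phi x.

Lemma ExD mu phi psi : Ex mu (fun x => phi x + psi x) = Ex mu phi + Ex mu psi.
Proof. by rewrite -big_split; apply: eq_bigr => x _; rewrite mulrDr. Qed.

Lemma ExZ mu a phi : Ex mu (fun x => a * phi x) = a * Ex mu phi.
Proof. by rewrite mulr_sumr; apply: eq_bigr => x _; rewrite mulrCA. Qed.

Lemma Ex_cst mu a : Ex mu (fun=> a) = a.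
Proof. by rewrite /Ex -mulr_suml pmf_sum1 mul1r. Qed.

Lemma eq_Ex mu phi psi : phi =1 psi -> Ex mu phi = Ex mu psi.
Proof. by move=> e; apply: eq_bigr => x _; rewrite e. Qed.

Lemma le_Ex_supp mu phi psi :
  (forall x, 0 < mu x -> phi x <= psi x) -> Ex mu phi <= Ex mu psi.
Proof.
move=> le; apply: ler_sum => x _.
have := pmf_ge0 mu x; rewrite le_eqVlt => /predU1P[<-|mux]; first by rewrite !mul0r.
by rewrite ler_pM2l ?le.
Qed.

Lemma le_Ex mu phi psi : (forall x, phi x <= psi x) -> Ex mu phi <= Ex mu psi.
Proof. by move=> le; apply: le_Ex_supp. Qed.

Lemma Ex_ge0 mu phi : (forall x, 0 <= phi x) -> 0 <= Ex mu phi.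
Proof. by move=> p0; rewrite -(Ex_cst mu 0); exact: le_Ex. Qed.

Lemma Ex_sum mu (I : finType) (phi : I -> T -> R) :
  Ex mu (fun x => \sum_i phi i x) = \sum_i Ex mu (phi i).
Proof.
rewrite /Ex exchange_big /=; apply: eq_bigr => x _.
by rewrite mulr_sumr.
Qed.

Lemma exists_le_Ex mu phi a : Ex mu phi <= a -> exists x, phi x <= a.
Proof.
move=> le; apply/not_existsP => gt.
have {}gt x : a < phi x by rewrite ltNge; apply/negP; exact: gt.
have : 0 < \sum_x mu x * (phi x - a).
  rewrite lt_def sumr_ge0 ?andbT => [|x _]; last first.
    by rewrite mulr_ge0 ?pmf_ge0 // subr_ge0 ltW.
  apply/negP => /eqP /psumr_eq0P e0.
  suff : \sum_x mu x = 0 by rewrite pmf_sum1 => /eqP; rewrite oner_eq0.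
  apply: big1 => x _.
  have /eqP := e0 (fun x _ => mulr_ge0 (pmf_ge0 mu x) (ltW (etrans (subr_gt0 _ _) (gt x)))) x isT.
  by rewrite mulf_eq0 subr_eq0 [phi x == a]gt_eqF ?gt // orbF => /eqP.
have -> : \sum_x mu x * (phi x - a) = Ex mu (fun x => phi x + - a) by [].
by rewrite ExD Ex_cst subr_gt0 ltNge le.
Qed.

End Expectation.

(** * Image, uniform and product distributions *)

Section Constructions.
Variable R : realType.

Section Push.
Variables (T U : finType) (mu : dist R T) (h : T -> U).

(** The image measure. With [mu] uniform and [h] a tuple of samples, it is the empirical
    distribution of the tuple. *)
Definition push_pmf : {ffun U -> R} := [ffun y => \sum_(x | h x == y) mu x].

Lemma push_pmf_ge0 y : 0 <= push_pmf y.
Proof. by rewrite ffunE sumr_ge0 // => x _; exact: pmf_ge0. Qed.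

Lemma push_pmf_sum1 : \sum_y push_pmf y = 1.
Proof.
rewrite -(pmf_sum1 mu) (partition_big h xpredT) //=.
by apply: eq_bigr => y _; rewrite ffunE.
Qed.

Definition push : dist R U := Dist push_pmf_ge0 push_pmf_sum1.

Lemma pushE y : push y = Ex mu (fun x => (h x == y)%:R).
Proof.
by rewrite ffunE big_mkcond; apply: eq_bigr => x _; case: eqP; rewrite ?mulr1 ?mulr0.
Qed.

Lemma Ex_push phi : Ex push phi = Ex mu (phi \o h).
Proof.
rewrite [RHS](partition_big h xpredT) //=; apply: eq_bigr => y _.
by rewrite ffunE mulr_suml; apply: eq_bigr => x /eqP ->.
Qed.

End Push.

Section Uniform.
Variable m : nat.

Definition unif_pmf : {ffun 'I_m.+1 -> R} := [ffun=> m.+1%:R^-1].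

Lemma unif_pmf_ge0 i : 0 <= unif_pmf i.
Proof. by rewrite ffunE invr_ge0. Qed.

Lemma unif_pmf_sum1 : \sum_i unif_pmf i = 1.
Proof.
under eq_bigr do rewrite ffunE.
by rewrite sumr_const card_ord -[_ *+ _]mulr_natr mulVf // pnatr_eq0.
Qed.

Definition unif : dist R 'I_m.+1 := Dist unif_pmf_ge0 unif_pmf_sum1.

Lemma Ex_unif phi : Ex unif phi = (\sum_i phi i) / m.+1%:R.
Proof. by rewrite mulrC mulr_sumr; apply: eq_bigr => i _; rewrite ffunE. Qed.

Lemma Ex_unif_card (P : pred 'I_m.+1) :
  Ex unif (fun i => (P i)%:R) = #|[set i | P i]|%:R / m.+1%:R.
Proof. rewrite Ex_unif -natr_sum -sum1_card [in RHS]big_mkcond; congr (_%:R / _).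
by apply: eq_bigr => i _; rewrite inE; case: (P i). Qed.

End Uniform.

Section IID.
Variables (T : finType) (mu : dist R T).

Definition iid_pmf m : {ffun {ffun 'I_m -> T} -> R} :=
  [ffun X : {ffun 'I_m -> T} => \prod_i mu (X i)].

Lemma iid_pmf_ge0 m X : 0 <= iid_pmf m X.
Proof. by rewrite ffunE prodr_ge0 // => i _; exact: pmf_ge0. Qed.

Lemma iid_pmf_sum1 m : \sum_X iid_pmf m X = 1.
Proof.
under eq_bigr do rewrite ffunE.
rewrite -(bigA_distr_bigA (fun (i : 'I_m) x => mu x)).
by rewrite big1 // => i _; exact: pmf_sum1.
Qed.

Definition iid m : dist R {ffun 'I_m -> T} := Dist (@iid_pmf_ge0 m) (@iid_pmf_sum1 m).

Lemma Ex_iid_prod m (F : 'I_m -> T -> R) :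
  Ex (iid m) (fun X => \prod_i F i (X i)) = \prod_i Ex mu (F i).
Proof.
rewrite bigA_distr_bigA; apply: eq_bigr => X _.
by rewrite ffunE -big_split.
Qed.

Definition cat_ffun s u (A : {ffun 'I_s -> T}) (B : {ffun 'I_u -> T}) :
    {ffun 'I_(s + u) -> T} :=
  [ffun k => match split k with inl i => A i | inr j => B j end].

Lemma cat_ffun_l s u (A : {ffun 'I_s -> T}) (B : {ffun 'I_u -> T}) i :
  cat_ffun A B (lshift u i) = A i.
Proof. by rewrite ffunE (unsplitK (inl i)). Qed.

Lemma cat_ffun_r s u (A : {ffun 'I_s -> T}) (B : {ffun 'I_u -> T}) i :
  cat_ffun A B (rshift s i) = B i.
Proof. by rewrite ffunE (unsplitK (inr i)). Qed.

(** Fubini for two independent blocks of samples: the second block can be analysed with the first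
    one fixed. *)
Lemma Ex_iid_cat s u (F : {ffun 'I_(s + u) -> T} -> R) :
  Ex (iid (s + u)) F = Ex (iid s) (fun A => Ex (iid u) (fun B => F (cat_ffun A B))).
Proof.
transitivity (\sum_A \sum_B (iid s A * iid u B) * F (cat_ffun A B)); last first.
  apply: eq_bigr => A _; rewrite mulr_sumr.
  by apply: eq_bigr => B _; rewrite mulrA.
rewrite pair_bigA /= /Ex (reindex (fun p => cat_ffun p.1 p.2)) /=.
  apply: eq_bigr => -[A B] _ /=; rewrite !ffunE big_split_ord /=.
  congr (_ * _ * _); apply: eq_bigr => i _; by rewrite ?cat_ffun_l ?cat_ffun_r.
exists (fun X => ([ffun i => X (lshift u i)], [ffun i => X (rshift s i)])).
- move=> -[A B] _ /=; congr (_, _); apply/ffunP => i;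
  by rewrite ffunE ?cat_ffun_l ?cat_ffun_r.
- move=> X _; apply/ffunP => k; rewrite -[k]splitK.
  by case: (split k) => i; rewrite /= ?cat_ffun_l ?cat_ffun_r !ffunE.
Qed.

(** On expanding the square, the off-diagonal terms vanish by independence and each of the [m]
    diagonal terms is at most 1. *)
Lemma Ex_iid_sqr_le m (psi : T -> R) :
  Ex mu psi = 0 -> (forall x, `|psi x| <= 1) ->
  Ex (iid m) (fun X => (\sum_k psi (X k)) ^+ 2) <= m%:R.
Proof.
move=> psi0 psi1.
have pairE k l : Ex (iid m) (fun X => psi (X k) * psi (X l)) <= (k == l)%:R.
  (* [F i] collects the factors of index [i]; for [k = l] both sit at the same index, so one product
     formula serves both cases. *)
  pose F i x := (if i == k then psi x else 1) * (if i == l then psi x else 1).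
  have -> : Ex (iid m) (fun X => psi (X k) * psi (X l)) = \prod_i Ex mu (F i).
    rewrite -Ex_iid_prod; apply: eq_Ex => X.
    by rewrite big_split /= -!big_mkcond !big_pred1_eq.
  have [kl|kl] := eqVneq k l.
    subst l.
    rewrite (bigD1 k) //= big1 => [|i /negPf il]; last first.
      by rewrite -[RHS](Ex_cst mu 1); apply: eq_Ex => x; rewrite /F il mulr1.
    rewrite mulr1 -[leRHS](Ex_cst mu 1); apply: le_Ex => x.
    by rewrite /F eqxx -expr2 -real_normK ?num_real // exprn_ile1.
  rewrite (bigD1 k) //=; suff -> : Ex mu (F k) = 0 by rewrite mul0r.
  by rewrite -psi0; apply: eq_Ex => x; rewrite /F eqxx (negPf kl) mulr1.
have -> : m%:R = \sum_(k < m) \sum_(l < m) (k == l)%:R :> R.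
  rewrite -[m in LHS]card_ord -sumr_const; apply: eq_bigr => k _.
  by rewrite (bigD1 k) //= eqxx big1 ?addr0 // => l /negPf; rewrite eq_sym => ->.
rewrite (eq_Ex _ (psi := fun X : {ffun 'I_m -> T} => \sum_k \sum_l psi (X k) * psi (X l))); last first.
  by move=> X; rewrite expr2 big_distrlr.
rewrite Ex_sum; apply: ler_sum => k _; rewrite Ex_sum; apply: ler_sum => l _.
exact: pairE.
Qed.

Lemma chebyshev_mean m (phi : T -> R) (delta : R) :
  0 < delta -> (forall x, 0 <= phi x <= 1) ->
  Ex (iid m.+1) (fun X => (delta < `|Ex (unif m) (phi \o X) - Ex mu phi|)%R%:R)
    <= (m.+1%:R * delta ^+ 2)^-1.
Proof.
move=> d0 phi01; set e := Ex mu phi.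
have e01 : 0 <= e <= 1.
  rewrite Ex_ge0 => [|x]; last by case/andP: (phi01 x).
  by rewrite -(Ex_cst mu 1) le_Ex // => x; case/andP: (phi01 x).
pose psi x := phi x - e.
have psi0 : Ex mu psi = 0 by rewrite /psi ExD Ex_cst subrr.
have psi1 x : `|psi x| <= 1.
  by rewrite ler_norml /psi; have := phi01 x; lra.
have := Ex_iid_sqr_le m.+1 psi0 psi1.
set M := m.+1%:R; have M0 : 0 < M by rewrite ltr0n.
move=> le; rewrite -[leRHS]mul1r ler_pdivlMr ?mulr_gt0 ?exprn_gt0 //.
rewrite -(ler_pM2r M0) mul1r -mulrA; apply: le_trans le.
rewrite mulrC -ExZ; apply: le_Ex => X.
case: ltP => [lt|_]; last by rewrite mulr0 sqr_ge0.
have -> : \sum_k psi (X k) = M * (Ex (unif m) (phi \o X) - e).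
  rewrite Ex_unif sumrB sumr_const card_ord -[_ *+ _]mulr_natr -/M /=.
  rewrite mulrBr mulrCA divff ?mulr1 1?mulrC //; exact: lt0r_neq0.
rewrite mulr1 exprMn -[(Ex _ _ - e) ^+ 2]real_normK ?num_real // //.
rewrite mulrAC -expr2 ler_pM2l ?exprn_gt0 //.
by rewrite lerXn2r ?nnegrE ?normr_ge0 1?ltW.
Qed.

Lemma chebyshev_means m (I : finType) (phi : I -> T -> R) (delta : R) :
  0 < delta -> (forall i x, 0 <= phi i x <= 1) ->
  9 * #|I|%:R <= m.+1%:R * delta ^+ 2 ->
  Ex (iid m.+1) (fun X =>
    [exists i, delta < `|Ex (unif m) (phi i \o X) - Ex mu (phi i)|]%R%:R) <= 1 / 9.
Proof.
move=> d0 phi01 le.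
apply: (@le_trans _ _ (\sum_i (m.+1%:R * delta ^+ 2)^-1)).
  apply: le_trans (_ : \sum_i Ex (iid m.+1)
    (fun X => (delta < `|Ex (unif m) (phi i \o X) - Ex mu (phi i)|)%R%:R) <= _).
    rewrite -Ex_sum; apply: le_Ex => X.
    case: existsP => [[i dev]|_]; last by rewrite sumr_ge0.
    by rewrite (bigD1 i) //= dev lerDl sumr_ge0.
  by apply: ler_sum => i _; exact: chebyshev_mean.
have M0 : 0 < m.+1%:R * delta ^+ 2 by rewrite mulr_gt0 ?exprn_gt0.
rewrite sumr_const -[_ *+ _]mulr_natl ler_pdivrMr //; lra.
Qed.

End IID.
End Constructions.

(** * Couplings *)

Section Hamming.
Variables (R : realType) (n : nat).
Implicit Types x y z : cube n.

Lemma dH_ge0 x y : 0 <= dH R x y.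
Proof. by rewrite divr_ge0. Qed.

Lemma dH_le1 x y : dH R x y <= 1.
Proof.
have [n0|n0] := posnP n.
  by rewrite /dH (_ : n%:R = 0 :> R) ?invr0 ?mulr0 // n0.
rewrite ler_pdivrMr ?ltr0n // mul1r ler_nat.
by apply: leq_trans (max_card _) _; rewrite card_ord.
Qed.

Lemma dHC x y : dH R x y = dH R y x.
Proof. by congr (_%:R / _); apply: eq_card => i; rewrite !inE eq_sym. Qed.

Lemma dHxx x : dH R x x = 0.
Proof.
rewrite /dH (eq_card0 (A := [set i | x i != x i])) ?mul0r // => i.
by rewrite inE eqxx.
Qed.

Lemma dH_triangle y x z : dH R x z <= dH R x y + dH R y z.
Proof.
rewrite -mulrDl ler_wpM2r ?invr_ge0 // -natrD ler_nat.
apply: leq_trans (leq_card_setU _ _); apply: subset_leq_card.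
apply/fintype.subsetP => i; rewrite !inE.
by case: (eqVneq (x i) (y i)) => // ->.
Qed.

Lemma dH_permute (s : 'S_n) x y : dH R (permute s x) (permute s y) = dH R x y.
Proof.
congr (_%:R / _); rewrite -[RHS](card_imset _ (@perm_inj _ s^-1%g)).
apply: eq_card => i; rewrite inE; apply/idP/imsetP => [ne|[j]].
  by exists (s i); rewrite ?permK // inE; move: ne; rewrite !ffunE.
by rewrite inE => ne ->; rewrite !ffunE permKV.
Qed.

End Hamming.

Section Transport.
Variables (R : realType) (n : nat).
Implicit Types (D E : dist R (cube n)) (f : {ffun cube n * cube n -> R}).

(** Bounding the cost of one explicit coupling composes well without the infimum in [dEM] having to
    be attained; coming from [dEM] costs an arbitrarily small slack. *)
Definition transportable D E c :=
  exists2 f, coupling D E f & transport_cost f <= c.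

Lemma transport_cost_ge0 D E f : coupling D E f -> 0 <= transport_cost f.
Proof.
move=> [f0 _ _]; apply: sumr_ge0 => x _; apply: sumr_ge0 => y _.
by rewrite mulr_ge0 ?dH_ge0.
Qed.

Lemma dEM_le_transport D E c : transportable D E c -> dEM D E <= c.
Proof.
move=> [f fDE fc]; apply: le_trans fc; apply: ge_inf; last by exists f.
by exists 0 => _ [g gDE ->]; exact: transport_cost_ge0 gDE.
Qed.

Lemma prod_coupling D E : coupling D E [ffun p => D p.1 * E p.2].
Proof.
split=> [p|x|y]; first by rewrite ffunE mulr_ge0 ?pmf_ge0.
  under eq_bigr do rewrite ffunE /=.
  by rewrite -mulr_sumr pmf_sum1 mulr1.
under eq_bigr do rewrite ffunE /=.
by rewrite -mulr_suml pmf_sum1 mul1r.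
Qed.

Lemma transportable_dEM D E c delta :
  0 < delta -> dEM D E <= c -> transportable D E (c + delta).
Proof.
move=> d0 dc.
have : has_inf [set c | exists2 f, coupling D E f & c = transport_cost f]%classic.
  split; first by exists (transport_cost [ffun p => D p.1 * E p.2]); exists [ffun p => D p.1 * E p.2] => //; exact: prod_coupling.
  by exists 0 => _ [g gDE ->]; exact: transport_cost_ge0 gDE.
move=> /(@inf_adherent _ _ _ d0)[_ [f fDE ->] lt].
by exists f => //; apply/ltW/(lt_le_trans lt); rewrite lerD2r.
Qed.

(** The joint law of [(x t, y t)] is a coupling, and its cost is this mean. *)
Lemma transportable_push (T : finType) (mu : dist R T) (x y : T -> cube n) :
  transportable (push mu x) (push mu y) (Ex mu (fun t => dH R (x t) (y t))).
Proof.
pose nu := push mu (fun t => (x t, y t)).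
exists nu; first split.
- exact: pmf_ge0.
- move=> a; rewrite pushE.
  under eq_bigr do rewrite pushE.
  rewrite -Ex_sum; apply: eq_Ex => t.
  have [->|ne] := eqVneq (x t) a.
    rewrite (bigD1 (y t)) //= eqxx big1 ?addr0 // => b /negPf nb.
    by rewrite xpair_eqE [y t == b]eq_sym nb andbF.
  by rewrite big1 // => b _; rewrite xpair_eqE (negPf ne).
- move=> b; rewrite pushE.
  under eq_bigr do rewrite pushE.
  rewrite -Ex_sum; apply: eq_Ex => t.
  have [->|ne] := eqVneq (y t) b.
    rewrite (bigD1 (x t)) //= eqxx big1 ?addr0 // => a /negPf nb.
    by rewrite xpair_eqE [x t == a]eq_sym nb.
  by rewrite big1 // => a _; rewrite xpair_eqE (negPf ne) andbF.
rewrite /transport_cost pair_bigA /=.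
rewrite (_ : \sum_p _ = Ex nu (fun p => dH R p.1 p.2)); first by rewrite Ex_push.
by apply: eq_bigr => -[].
Qed.

Lemma transportable_eql D D' E c : D =1 D' -> transportable D E c -> transportable D' E c.
Proof.
move=> DD' [f [f0 fD fE] fc]; exists f => //; split=> // x.
by rewrite fD DD'.
Qed.

Lemma transportable_eqr D E E' c : E =1 E' -> transportable D E c -> transportable D E' c.
Proof.
move=> EE' [f [f0 fD fE] fc]; exists f => //; split=> // x.
by rewrite fE EE'.
Qed.

Lemma push_id D : push D id =1 D.
Proof. by move=> x; rewrite ffunE big_pred1_eq. Qed.

(* Gluing of the two couplings along [E]; where [E y = 0] both couplings vanish
   and so does the junk value [0 / 0 = 0]. *)
Lemma transportable_trans E D F a b :
  transportable D E a -> transportable E F b -> transportable D F (a + b).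
Proof.
move=> [f [f0 fD fE] fa] [g [g0 gE gF] gb].
pose h x y z := f (x, y) * g (y, z) / E y.
have hz x y : \sum_z h x y z = f (x, y).
  rewrite -mulr_suml -mulr_sumr gE -mulrA.
  have [E0|E0] := eqVneq (E y) 0; last by rewrite divff ?mulr1.
  have /psumr_eq0P f00 : \sum_x f (x, y) = 0 by rewrite fE.
  by rewrite f00 // !mul0r.
have hx y z : \sum_x h x y z = g (y, z).
  rewrite -mulr_suml -mulr_suml fE mulrAC.
  have [E0|E0] := eqVneq (E y) 0; last by rewrite divff ?mul1r.
  have /psumr_eq0P g00 : \sum_z g (y, z) = 0 by rewrite gE.
  by rewrite g00 // mulr0.
have h0 x y z : 0 <= h x y z by rewrite divr_ge0 ?mulr_ge0 ?pmf_ge0.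
exists [ffun p => \sum_y h p.1 y p.2]; first split.
- by move=> p; rewrite ffunE sumr_ge0.
- move=> x; under eq_bigr do rewrite ffunE /=.
  by rewrite exchange_big /= -fD; apply: eq_bigr => y _; rewrite hz.
- move=> z; under eq_bigr do rewrite ffunE /=.
  by rewrite exchange_big /= -gF; apply: eq_bigr => y _; rewrite hx.
apply: le_trans (lerD fa gb).
have -> : transport_cost f = \sum_x \sum_y \sum_z h x y z * dH R x y.
  by apply: eq_bigr => x _; apply: eq_bigr => y _; rewrite -mulr_suml hz.
have -> : transport_cost g = \sum_x \sum_y \sum_z h x y z * dH R y z.
  rewrite exchange_big /=; apply: eq_bigr => y _; rewrite exchange_big /=.
  by apply: eq_bigr => z _; rewrite -mulr_suml hx.
rewrite -big_split /=; apply: ler_sum => x _.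
apply: (@le_trans _ _ (\sum_z \sum_y h x y z * dH R x z)).
  by apply: ler_sum => z _; rewrite ffunE mulr_suml.
rewrite exchange_big -big_split /=; apply: ler_sum => y _.
rewrite -big_split; apply: ler_sum => z _ /=.
by rewrite -mulrDr ler_wpM2l // dH_triangle.
Qed.

Lemma transportable_le D E a b : a <= b -> transportable D E a -> transportable D E b.
Proof. by move=> ab [f fDE fa]; exists f => //; exact: le_trans ab. Qed.

(* The common part of [D] and [E] stays in place; the excess of [D] is spread
   over the excess of [E] proportionally. *)
Lemma transportable_tv D E :
  transportable D E (\sum_x `|D x - E x|).
Proof.
pose p x := Num.max 0 (D x - E x); pose q x := Num.max 0 (E x - D x).
have p0 x : 0 <= p x by rewrite le_max lexx.
have q0 x : 0 <= q x by rewrite le_max lexx.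
pose t := \sum_x p x.
have pq x : p x - q x = D x - E x.
  by rewrite /p /q; case: (lerP 0 (D x - E x)); case: (lerP 0 (E x - D x)) => ? ?; lra.
have tq : \sum_x q x = t.
  apply/eqP; rewrite eq_sym -subr_eq0 -sumrB; under eq_bigr do rewrite pq.
  by rewrite sumrB !pmf_sum1 subrr.
have m0 x : 0 <= D x - p x.
  by have := pmf_ge0 D x; have := pmf_ge0 E x; rewrite /p; case: (lerP 0 (D x - E x)) => ? ? ?; lra.
pose f := [ffun r : cube n * cube n =>
  (r.1 == r.2)%:R * (D r.1 - p r.1) + p r.1 * q r.2 / t].
(* When [t = 0] both excesses vanish identically, so division by zero gives the right value. *)
have tp x : p x * t / t = p x.
  have [t0|t0] := eqVneq t 0; last by rewrite mulfK.
  by rewrite (psumr_eq0P _ t0) // !mul0r.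
have tq' y : t * q y / t = q y.
  have [t0|t0] := eqVneq t 0; last by rewrite mulrAC divff ?mul1r.
  by move: t0; rewrite -tq => t0; rewrite (psumr_eq0P _ t0) // mulr0 mul0r.
have t0 : 0 <= t by exact: sumr_ge0.
exists f; first split.
- by move=> r; rewrite /f ffunE addr_ge0 ?mulr_ge0 ?invr_ge0 //; case: eqP.
- move=> x; under eq_bigr do rewrite /f ffunE /=.
  rewrite big_split /= -mulr_suml -mulr_suml -mulr_sumr tq tp.
  rewrite (bigD1 x) //= eqxx big1 => [|y /negPf]; last by rewrite eq_sym => ->.
  by rewrite addr0 mul1r subrK.
- move=> y; under eq_bigr do rewrite /f ffunE /=.
  rewrite big_split /= -mulr_suml -mulr_suml tq'.
  rewrite (bigD1 y) //= eqxx big1 => [|x /negPf ->]; last by rewrite mul0r.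
  by rewrite addr0 mul1r; have := pq y; lra.
apply: (@le_trans _ _ (\sum_x \sum_y p x * q y / t)).
  apply: ler_sum => x _; apply: ler_sum => y _; rewrite /f ffunE /=.
  have [<-|ne] := eqVneq x y; first by rewrite dHxx mulr0 divr_ge0 ?mulr_ge0.
  by rewrite mul0r add0r ler_piMr ?dH_le1 // divr_ge0 ?mulr_ge0.
apply: ler_sum => x _; rewrite -mulr_suml -mulr_sumr tq tp.
by rewrite ge_max normr_ge0 ler_norm.
Qed.

End Transport.

(** * Nets for sets of bounded VC-dimension *)

Section Packing.
Variable n : nat.
Implicit Types (G V : {set cube n}) (I J : seq 'I_n).

(** Lists replace tuples so that coordinates can be added one at a time in an induction. *)
Definition shatters_seq G J :=
  forall p : seq bool, size p = size J -> exists2 x : cube n, x \in G & map x J = p.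

(** Induction on [I], with [G] determined by its traces on [I]. Split off the points having a twin
    in [G] with the same trace on the tail but another bit at the head. The rest is determined by
    the tail, and the part split off shatters nothing of length [e - 1] there. *)
Lemma sauer_shelah e I G :
  {in G &, injective (fun x : cube n => map x I)} ->
  (forall J, size J = e -> {subset J <= I} -> ~ shatters_seq G J) ->
  (#|G| <= (size I).+1 ^ e)%N.
Proof.
elim: I e G => [|i I IH] e G inj noS.
  rewrite exp1n leqNgt; apply/negP => /card_gt1P[x [y [xG yG /eqP]]].
  by apply; exact: inj.
case: e noS => [|e] noS.
  rewrite expn0 leqNgt; apply/negP => /ltnW/card_gt0P[x xG].
  by apply: (noS [::]) => // -[] // _; exists x.
pose G2 := [set x in G | x i && [exists y in G, ~~ y i && (map y I == map x I)]].
have sG2 : G2 \subset G by apply/fintype.subsetP => x; rewrite inE => /andP[].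
have c1 : (#|G :\: G2| <= (size I).+1 ^ e.+1)%N.
  apply: IH => [x y|J sJ subJ shJ].
    rewrite !inE => /andP[xG2 xG] /andP[yG2 yG] xy; apply: inj => //=.
    rewrite xy; congr (_ :: _); move: xG2 yG2; rewrite xG yG /=.
    case xi: (x i); case yi: (y i) => //=.
      by move=> /negP[]; apply/exists_inP; exists y; rewrite // yi xy eqxx.
    by move=> _ /negP[]; apply/exists_inP; exists x; rewrite // xi xy eqxx.
  apply: (noS J) => // [j jJ|p /shJ[x]].
    by rewrite inE subJ ?orbT.
  by rewrite inE => /andP[_ xG] xp; exists x.
(* If [G2] shatters [J], then together with the twins [G] shatters [i :: J]. *)
have c2 : (#|G2| <= (size I).+1 ^ e)%N.
  apply: IH => [x y|J sJ subJ shJ].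
    rewrite !inE => /and3P[xG xi _] /and3P[yG yi _] xy; apply: inj => //=.
    by rewrite xy xi yi.
  apply: (noS (i :: J)) => [|j|[|b p] //= [/shJ[x]]] /=.
  - by rewrite sJ.
  - by rewrite !inE => /predU1P[->|/subJ ->]; rewrite ?eqxx ?orbT.
  rewrite inE => /and3P[xG xi /exists_inP[y yG /andP[yi /eqP yx]]] xp.
  have yJ : map y J = p.
    rewrite -xp; apply/eq_in_map => j /subJ jI.
    exact: (proj2 (eq_in_map y x I) yx j jI).
  case: b; first by exists x; rewrite // xi xp.
  by exists y; rewrite // (negPf yi) yJ.
rewrite -(cardsID G2) (finset.setIidPr sG2).
apply: leq_trans (leq_add c2 c1) _.
(* With [k = (size I).+1] the two bounds add up to [k.+1 * k ^ e], which is at most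
   [k.+1 ^ e.+1]. *)
rewrite expnS -mulSn /= expnS; apply: leq_mul => //.
by case: (e) => [|e']; rewrite ?expn0 ?leq_exp2r.
Qed.

Lemma shatters_seq_VCdim V J : shatters_seq V J -> (size J <= VCdim V)%N.
Proof.
move=> shJ; apply: (@shatters_leq_VCdim _ V (size J) (in_tuple J)).
apply/eqP/setP => p; rewrite [RHS]inE; apply/imsetP.
have [x xV xp] := shJ p (size_tuple p).
exists x => //; apply: eq_from_tnth => j.
rewrite tnth_mktuple (tnth_nth true) -xp (nth_map (tnth (in_tuple J) j)) //.
by rewrite [in RHS](tnth_nth (tnth (in_tuple J) j)).
Qed.

End Packing.

(** * Separated sets and nets *)

Section Nets.
Variables (R : realType).

(** Exponential decay beats a polynomial. Take [m] as [j] blocks of length [L], each contributing a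
    factor at most 1/2; it remains to compare the polynomial with [2 ^ j]. *)
Lemma poly_exp_lt1 (d : nat) (delta : R) : 0 < delta <= 1 ->
  exists m : nat, ((m.+1 ^ d).+1 ^ 2)%N%:R * (1 - delta) ^+ m < 1.
Proof.
move=> /andP[d0 d1].
have q0 : 0 <= 1 - delta by lra.
have [L L0 half] : exists2 L : nat, (0 < L)%N & (1 - delta) ^+ L <= 2^-1.
  pose L := (Num.bound (delta^-1)); have Ld : delta^-1 < L%:R.
    by apply: archi_boundP; rewrite invr_ge0 ltW.
  have L0 : 0 < L%:R :> R by apply: lt_trans Ld; rewrite invr_gt0.
  exists L; first by rewrite -(ltr0n R).
  (* Bernoulli's inequality: the left side is at most [(1 - delta ^+ 2) ^+ L], and [delta *+ L]
     exceeds 1. *)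
  have : (1 - delta) ^+ L * (1 + delta *+ L) <= 1.
    apply: le_trans (_ : (1 - delta) ^+ L * (1 + delta) ^+ L <= _).
      rewrite ler_wpM2l ?exprn_ge0 //.
      elim: (L) => [|k IH]; first by rewrite mulr0n addr0 expr0.
      rewrite mulrS exprS; apply: le_trans (_ : (1 + delta) * (1 + delta *+ k) <= _).
        have : 0 <= delta * (delta *+ k) by rewrite mulr_ge0 ?mulrn_wge0 ?ltW.
        by set x := delta *+ k; lra.
      by rewrite ler_wpM2l //; lra.
    rewrite -exprMn exprn_ile1 //; [|]; nra.
  have : 1 < delta *+ L by rewrite -mulr_natr mulrC -ltr_pdivrMr // mul1r.
  have := exprn_ge0 L q0; set x := _ ^+ L; set y := delta *+ L; nra.
(* As [j] is exponential in [k], [m.+1 <= 2 ^ (a + 2 * k)], so the polynomial is a power of 2 with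
   exponent linear in [k]. The constants in [k] put this exponent below [j = 2 ^ (2 * k)]. *)
pose a := L.*2; pose k := (8 * d + 2 * d * a + 8)%N.
pose j := (2 ^ (2 * k))%N; pose m := (L * j)%N; exists m.
have kgt : ((2 * d * (a + 2 * k) + 2) < 2 ^ (2 * k))%N.
  have : (k < 2 ^ k)%N by rewrite ltn_expl.
  have -> : (2 ^ (2 * k) = 2 ^ k * 2 ^ k)%N by rewrite mul2n -addnn expnD.
  move: (2 ^ k)%N => z kz.
  have h1 : (2 * d * a + 2 <= k)%N by rewrite /k; lia.
  have h2 : (4 * d * k <= k * k)%N by rewrite leq_mul2r /k; apply/orP; right; lia.
  have h3 : (k.+1 * k.+1 <= z * z)%N by rewrite leq_mul.
  by move: h1 h2 h3; move: (k) => k'; nia.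
have mle : (m.+1 <= 2 ^ (a + 2 * k))%N.
  have : (a < 2 ^ a)%N by rewrite ltn_expl.
  have : (0 < 2 ^ (2 * k))%N by rewrite expn_gt0.
  rewrite /m /j expnD /a; move: (2 ^ (2 * k))%N (2 ^ L.*2)%N => z w; nia.
have nle : ((m.+1 ^ d).+1 ^ 2 < 2 ^ j)%N.
  apply: leq_ltn_trans (_ : 2 ^ (2 * d * (a + 2 * k) + 2) < _)%N; last by rewrite ltn_exp2l.
  have h : (m.+1 ^ d <= 2 ^ (d * (a + 2 * k)))%N.
    by rewrite mulnC expnM; case: (d) => // d'; rewrite leq_exp2r.
  rewrite expnD -mulnA mulnC mulnA [(2 ^ 2 * _)%N]mulnC -mulnA.
  have -> : (2 ^ (2 * (d * (a + 2 * k))) = (2 ^ (d * (a + 2 * k))) ^ 2)%N by rewrite mulnC expnM.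
  have : (0 < 2 ^ (d * (a + 2 * k)))%N by rewrite expn_gt0.
  move: h; move: (m.+1 ^ d)%N (2 ^ (d * (a + 2 * k)))%N => x y; rewrite !expnS !expn0; nia.
have -> : (1 - delta) ^+ m = ((1 - delta) ^+ L) ^+ j by rewrite exprM.
apply: le_lt_trans (_ : ((m.+1 ^ d).+1 ^ 2)%N%:R * 2^-1 ^+ j < _).
  by rewrite ler_wpM2l // lerXn2r ?nnegrE ?exprn_ge0 // invr_ge0.
by rewrite exprVn ltr_pdivrMr ?exprn_gt0 // mul1r -natrX ltr_nat.
Qed.

Lemma card_natr (T : finType) (A : {set T}) : #|A|%:R = \sum_x (x \in A)%:R :> R.
Proof. by rewrite -sum1_card big_mkcond natr_sum; apply: eq_bigr => x _; case: ifP. Qed.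

Lemma dH_Ex n (x y : cube n.+1) : dH R x y = Ex (unif R n) (fun i => (x i != y i)%:R).
Proof. by rewrite Ex_unif_card. Qed.

(* A uniformly random further coordinate separates, in expectation, a fraction
   [delta] of the pairs not separated so far. *)
Lemma separating_coordinates n (S : {set cube n.+1}) (delta : R) m :
  delta <= 1 -> {in S &, forall x y, x != y -> delta < dH R x y} ->
  exists2 I : seq 'I_n.+1, size I = m &
    #|[set p in finset.setX S S | (p.1 != p.2) && (map p.1 I == map p.2 I)]|%:R
      <= (1 - delta) ^+ m * (#|S| ^ 2)%N%:R.
Proof.
move=> d1 sepS.
elim: m => [|m [I sI le]].
  exists [::] => //; rewrite expr0 mul1r ler_nat -mulnn -cardsX.
  by apply: subset_leq_card; apply/fintype.subsetP => p; rewrite inE => /andP[].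
pose U I := [set p in finset.setX S S | (p.1 != p.2) && (map p.1 I == map p.2 I)].
suff /exists_le_Ex[i lei] : Ex (unif R n) (fun i => #|U (i :: I)|%:R)
    <= (1 - delta) * #|U I|%:R.
  exists (i :: I); first by rewrite /= sI.
  apply: le_trans lei _; rewrite exprS -mulrA; apply: ler_wpM2l => //; lra.
have UE i : #|U (i :: I)|%:R = \sum_p (p \in U I)%:R * (1 - (p.1 i != p.2 i)%:R) :> R.
  rewrite card_natr; apply: eq_bigr => p _; rewrite !inE /= eqseq_cons.
  by case: (p.1 i == p.2 i); rewrite ?andbF ?andbT ?subr0 ?subrr ?mulr0 ?mulr1.
rewrite (eq_Ex _ UE) Ex_sum mulrC card_natr mulr_suml; apply: ler_sum => p _.
rewrite ExZ; case pU: (p \in U I); last by rewrite !mul0r.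
rewrite !mul1r (eq_Ex _ (psi := fun i => 1 + -1 * (p.1 i != p.2 i)%:R)); last first.
  by move=> i; rewrite mulN1r.
rewrite ExD ExZ Ex_cst -dH_Ex.
move: pU; rewrite !inE => /andP[/andP[p1 p2] /andP[ne _]].
by have := sepS _ _ p1 p2 ne; lra.
Qed.

(** If [S] were larger, some [m] coordinates would leave fewer than one pair, hence none,
    unseparated; the traces would be distinct and Sauer-Shelah would bound their number. *)
Lemma separated_card n (V : {set cube n.+1}) (S : {set cube n.+1}) (delta : R) d m :
  0 < delta <= 1 -> (VCdim V <= d)%N -> S \subset V ->
  {in S &, forall x y, x != y -> delta < dH R x y} ->
  ((m.+1 ^ d.+1).+1 ^ 2)%N%:R * (1 - delta) ^+ m < 1 ->
  (#|S| <= m.+1 ^ d.+1)%N.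
Proof.
move=> /andP[d0 d1] Vd SV sepS lt1; rewrite leqNgt; apply/negP => gtS.
(* The hypothesis on [m] controls the number of pairs only for a set of exactly this size, one above
   the claimed bound. *)
have [T TS cT] : exists2 T : {set cube n.+1}, T \subset S & #|T| = (m.+1 ^ d.+1).+1.
  exists [set x in take (m.+1 ^ d.+1).+1 (enum S)].
    by apply/fintype.subsetP => x; rewrite inE => /mem_take; rewrite mem_enum.
  rewrite cardsE (card_uniqP _) ?take_uniq ?enum_uniq // size_take -cardE.
  by case: ltnP => // le; apply/eqP; rewrite eqn_leq le.
have sepT : {in T &, forall x y, x != y -> delta < dH R x y}.
  by move=> x y xT yT; apply: sepS; exact: (fintype.subsetP TS).
have [I sI] := separating_coordinates m d1 sepT.
rewrite cT mulrC => /le_lt_trans /(_ lt1); rewrite -[1]/(1%:R) ltr_nat ltnS leqn0.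
rewrite cards_eq0 => /eqP U0.
have : (#|T| <= (size I).+1 ^ d.+1)%N.
  apply: sauer_shelah => [x y xT yT xy|J sJ _ shJ].
    apply/eqP/negPn/negP => ne.
    have : (x, y) \in @finset.set0 (cube n.+1 * cube n.+1)%type.
      by rewrite -U0 !inE /= xT yT ne xy eqxx.
    by rewrite inE.
  have shV : shatters_seq V J.
    move=> p /shJ[x xT xp]; exists x => //.
    exact: (fintype.subsetP (fintype.subset_trans TS SV)).
  by have := shatters_seq_VCdim shV; rewrite sJ leqNgt ltnS Vd.
by rewrite cT sI ltnn.
Qed.

(** A maximal [delta]-separated subset of [V] is a [delta]-net of [V], and [separated_card] bounds
    its size independently of [n]. *)
Lemma VCdim_net (d : nat) (delta : R) : 0 < delta ->
  exists K : nat, forall n (V : {set cube n}), (VCdim V <= d)%N ->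
    exists c : 'I_K.+1 -> cube n, forall x, x \in V -> exists i, dH R x (c i) <= delta.
Proof.
move=> d0.
wlog d1 : delta d0 / delta <= 1.
  move=> wl; have m0 : 0 < Num.min delta 1 by rewrite lt_min d0 ltr01.
  have m1 : Num.min delta 1 <= 1 by rewrite ge_min lexx orbT.
  have [K netK] := wl _ m0 m1; exists K => n V /netK[c cV].
  exists c => x /cV[i le]; exists i; apply: le_trans le _.
  by rewrite ge_min lexx.
have d01 : 0 < delta <= 1 by rewrite d0.
have [m lt1] := poly_exp_lt1 d.+1 d01.
exists (m.+1 ^ d.+1)%N => -[V _|n V Vd].
  exists (fun=> [ffun=> true]) => x _; exists ord0.
  by rewrite /dH invr0 mulr0 ltW.
pose sep (S : {set cube n.+1}) := (S \subset V) &&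
  [forall x in S, forall y in S, (x != y) ==> (delta < dH R x y)].
have sep0 : sep finset.set0.
  by rewrite /sep finset.sub0set; apply/forall_inP => x; rewrite inE.
case: (@arg_maxnP _ finset.set0 sep (fun S => #|S|) sep0) => S /andP[SV /forall_inP sepS] maxS.
have {}sepS : {in S &, forall x y, x != y -> delta < dH R x y}.
  by move=> x y /sepS /forall_inP h /h /implyP.
have cS := separated_card d01 Vd SV sepS lt1.
(* Indices beyond the size of [S] give the default point, a harmless extra centre. *)
exists (fun i => nth [ffun=> true] (enum S) i) => x xV.
suff [y yS le] : exists2 y, y \in S & dH R x y <= delta.
  have yE : (index y (enum S) < size (enum S))%N by rewrite index_mem mem_enum.
  have yK : (index y (enum S) < (m.+1 ^ d.+1).+1)%N.
    by rewrite ltnS; apply: leq_trans (ltnW yE) _; rewrite -cardE.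
  by exists (Ordinal yK); rewrite /= nth_index ?mem_enum.
have [xS|xS] := boolP (x \in S); first by exists x; rewrite // dHxx ltW.
apply/exists_inP; apply: contraT => /exists_inPn far.
suff /maxS : sep (x |: S) by rewrite /= cardsU1 xS ltnn.
rewrite /sep finset.subUset finset.sub1set xV SV /=.
apply/forall_inP => y; rewrite !inE => yS; apply/forall_inP => z; rewrite !inE => zS.
apply/implyP => yz.
case/predU1P: yS => [yx|yS]; case/predU1P: zS => [zx|zS].
- by rewrite yx zx eqxx in yz.
- by rewrite yx ltNge far.
- by rewrite zx dHC ltNge far.
- exact: sepS.
Qed.

End Nets.

(** * Empirical distributions and reconstruction *)

Section Centres.
Variables (R : realType) (n K : nat) (c : 'I_K.+1 -> cube n).
Implicit Types (D E : dist R (cube n)) (y : cube n).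

Definition nearest y : 'I_K.+1 := [arg min_(i < ord0) dH R y (c i)]%O.
Definition dist_to y : R := dH R y (c (nearest y)).

Lemma dist_to_le y i : dist_to y <= dH R y (c i).
Proof. by rewrite /dist_to /nearest; case: Order.TotalTheory.arg_minP => // j _; apply. Qed.

(** The distance to the centres is 1-Lipschitz, so its mean changes by at most the transport
    cost. *)
Lemma Ex_dist_to_le D E a e : transportable D E a ->
  (forall y, 0 < E y -> dist_to y <= e) -> Ex D dist_to <= a + e.
Proof.
move=> [f [f0 fD fE] fa] near.
have fe : \sum_x \sum_y f (x, y) * e = e.
  by rewrite exchange_big /= -[RHS](Ex_cst E e); apply: eq_bigr => y _; rewrite -fE mulr_suml.
rewrite -fe; apply: le_trans (lerD fa (lexx _)).
rewrite -big_split; apply: ler_sum => x _ /=.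
rewrite -fD mulr_suml -big_split; apply: ler_sum => y _ /=.
rewrite -mulrDr; have := f0 (x, y); rewrite le_eqVlt => /predU1P[<-|fxy].
  by rewrite !mul0r.
rewrite ler_pM2l //; apply: le_trans (dist_to_le x (nearest y)) _.
apply: le_trans (dH_triangle _ y _ _) _; rewrite lerD2l; apply: near.
by rewrite -fE (bigD1 x) //= ltr_pwDl // sumr_ge0.
Qed.

Variables (D : dist R (cube n)) (delta : R).

Definition statistic (i : option 'I_K.+1) y : R :=
  if i is Some j then (nearest y == j)%:R else dist_to y.

(** The tolerance is divided by the number of Voronoi cells, so that the errors in all cell weights
    add up to at most [delta]. *)
Definition representative u (B : {ffun 'I_u.+1 -> cube n}) : bool :=
  ~~ [exists i, (delta / K.+1%:R <
        `|Ex (unif R u) (statistic i \o B) - Ex D (statistic i)|)%R].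

Lemma representative_prob u : 0 < delta ->
  9 * K.+2%:R <= u.+1%:R * (delta / K.+1%:R) ^+ 2 ->
  Ex (iid D u.+1) (fun B => (~~ representative B)%:R) <= 1 / 9.
Proof.
move=> d0 le; rewrite (eq_Ex _ (psi := fun B : {ffun 'I_u.+1 -> cube n} => [exists i, (delta / K.+1%:R <
   `|Ex (unif R u) (statistic i \o B) - Ex D (statistic i)|)%R]%:R)).
  by apply: chebyshev_means; rewrite ?divr_gt0 // ?card_option ?card_ord // =>
    -[i|] y /=; rewrite ?dH_ge0 ?dH_le1 //; case: eqP; rewrite ?lexx ?ler01.
by move=> B; rewrite /representative negbK.
Qed.

Section Consequences.
Variables (u : nat) (B : {ffun 'I_u.+1 -> cube n}).
Hypothesis repB : representative B.

Lemma representative_dist_to :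
  0 < delta -> `|Ex (unif R u) (dist_to \o B) - Ex D dist_to| <= delta.
Proof.
move=> d0; have /existsPn/(_ None) := repB; rewrite -leNgt => /le_trans; apply.
by rewrite ler_pdivrMr // ler_peMr ?ler1n // ltW.
Qed.

Lemma push_nearest (T : finType) (mu : dist R T) (h : T -> cube n) x :
  push mu (c \o nearest \o h) x
    = \sum_j (c j == x)%:R * Ex mu (statistic (Some j) \o h).
Proof.
under eq_bigr do rewrite -ExZ.
rewrite -Ex_sum pushE; apply: eq_Ex => t /=.
rewrite (bigD1 (nearest (h t))) //= eqxx mulr1 big1 ?addr0 // => j /negPf.
by rewrite eq_sym => ->; rewrite mulr0.
Qed.

(** Move [D] to the nearest centres, correct the cell weights to those of [B] at cost [delta], then
    move each centre to the point [W k]. Leaving [W] free allows both the samples themselves and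
    their reconstruction. *)
Lemma representative_transport (W : 'I_u.+1 -> cube n) :
  transportable D (push (unif R u) W)
    (Ex D dist_to + delta + Ex (unif R u) (fun k => dH R (c (nearest (B k))) (W k))).
Proof.
apply: (transportable_trans (E := push (unif R u) (c \o nearest \o B))); last first.
  exact: transportable_push.
apply: (transportable_trans (E := push D (c \o nearest \o id))).
  by apply: (transportable_eql (push_id D)); exact: transportable_push.
apply: transportable_le (transportable_tv _ _).
apply: (@le_trans _ _ (\sum_x \sum_j (c j == x)%:R * (delta / K.+1%:R))).
  apply: ler_sum => x _; rewrite !push_nearest -sumrB.
  apply: le_trans (ler_norm_sum _ _ _) _; apply: ler_sum => j _.
  rewrite -mulrBr normrM ger0_norm // ler_wpM2l //.
  by have /existsPn/(_ (Some j)) := repB; rewrite -leNgt distrC.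
rewrite exchange_big /=; under eq_bigr => j _.
  rewrite (bigD1 (c j)) //= eqxx mul1r big1 ?addr0; last first.
    by move=> x /negPf; rewrite eq_sym => ->; rewrite mul0r.
  over.
by rewrite sumr_const card_ord -[_ *+ _]mulr_natr divfK ?pnatr_eq0.
Qed.

End Consequences.
End Centres.

(** * Optimal matching of two colourings *)

Section Matching.
Variables (I T : finType) (a b : I -> T).

(* Take the permutation with the fewest mismatches: by a swap, no colour can be
   both missed by [a] and by [b \o s]. *)
Lemma matching_perm : exists s : {perm I},
  (#|[set i | a i != b (s i)]|
     <= \sum_t (#|[set i | a i == t]| - #|[set i | b i == t]|))%N.
Proof.
pose M (s : {perm I}) := [set i | a i != b (s i)].
case: (@arg_minnP _ (1%g : {perm I}) xpredT (fun s => #|M s|) isT) => s _ minM.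
exists s; rewrite -sum1_card (partition_big a xpredT) //=.
apply: leq_sum => t _; rewrite sum1dep_card.
have cb : #|[set i | b i == t]| = #|[set i | b (s i) == t]|.
  rewrite -(card_imset [set i | b (s i) == t] (@perm_inj _ s)).
  apply: eq_card => i; rewrite inE; apply/idP/imsetP => [bi|[j]].
    by exists (s^-1%g i); rewrite ?inE permKV.
  by rewrite inE => bj ->.
rewrite cb.
pose L : {set I} := [set i in [set i | a i != b (s i)] | a i == t].
rewrite -/L.
have [->|[i iL]] := finset.set_0Vmem L; first by rewrite cards0.
have {iL} [ai bi] : a i = t /\ b (s i) != t.
  by move: iL; rewrite !inE => /andP[ne /eqP <-]; rewrite eq_sym.
(* Otherwise exchanging the images of [i] and [j] repairs [i] and spoils nothing, against
   minimality. *)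
have sub : [set j | b (s j) == t] \subset [set j | a j == t].
  apply/fintype.subsetP => j; rewrite !inE => bj; apply: contraT => aj.
  have : (#|M (tperm i j * s)%g| < #|M s|)%N.
    apply: proper_card; apply/properP; split.
      apply/fintype.subsetP => k; rewrite !inE permM.
      case: tpermP => [->|->|//]; first by rewrite ai (eqP bj) eqxx.
      by rewrite (eqP bj).
    exists i; first by rewrite inE ai eq_sym.
    by rewrite inE permM tpermL ai (eqP bj) eqxx.
  by rewrite ltnNge minM.
have -> : L = [set j | a j == t] :\: [set j | b (s j) == t].
  apply/setP => j; rewrite !inE andbC.
  by case: eqP => [->|_]; rewrite ?andbF // andbT eq_sym.
by rewrite cardsDS.
Qed.

End Matching.

(** * Recovering the samples from column frequencies *)

Section Reconstruction.
Variables (R : realType) (n m N : nat).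
Implicit Types (X W : {ffun 'I_N -> cube n.+1}) (r : {ffun 'I_m.+1 -> 'I_n.+1})
  (delta : R).

Definition column X i : {ffun 'I_N -> bool} := [ffun k => X k i].

(** Unread bits become [false]; for a view read with [random_queries r], the columns at the
    coordinates [r l] never meet this default. *)
Definition view_column (v : view n.+1 N) i : {ffun 'I_N -> bool} :=
  [ffun k => odflt false (v k i)].

Definition random_queries r : {ffun 'I_N -> {set 'I_n.+1}} :=
  [ffun=> [set r l | l : 'I_m.+1]].

Definition consistent delta r (v : view n.+1 N) W : bool :=
  [forall t, `|Ex (unif R m) (fun l => (view_column v (r l) == t)%:R)
               - Ex (unif R n) (fun i => (column W i == t)%:R)| <= delta].

Definition reconstruct delta r v : {ffun 'I_N -> cube n.+1} :=
  odflt [ffun=> [ffun=> true]] [pick W | consistent delta r v W].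

Definition perm_close delta X W : bool :=
  [exists s : 'S_n.+1, [forall k, dH R (X k) (permute s (W k)) <= delta]].

Lemma view_column_read r X l :
  view_column (read (random_queries r) X) (r l) = column X (r l).
Proof.
apply/ffunP => k; rewrite !ffunE (_ : r l \in _) //.
by apply/imsetP; exists l.
Qed.

(** Match equal columns as far as possible: each of the [2 ^ N] column types leaves a fraction at
    most [delta] of the coordinates mismatched, and a sample can differ only at those. *)
Lemma perm_close_columns delta X W :
  (forall t, `|Ex (unif R n) (fun i => (column X i == t)%:R)
               - Ex (unif R n) (fun i => (column W i == t)%:R)| <= delta) ->
  perm_close (delta * (2 ^ N)%N%:R) X W.
Proof.
move=> le; have [s sP] := matching_perm (column X) (column W).
apply/existsP; exists s; apply/forallP => k.
apply: (@le_trans _ _ (#|[set i | column X i != column W (s i)]|%:R / n.+1%:R)).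
  rewrite ler_wpM2r ?invr_ge0 // ler_nat; apply: subset_leq_card.
  apply/fintype.subsetP => i; rewrite !inE; apply: contraNN => /eqP/ffunP/(_ k).
  by rewrite !ffunE => ->.
rewrite ler_pdivrMr //.
apply: (@le_trans _ _ (\sum_(t : {ffun 'I_N -> bool}) delta * n.+1%:R)); last first.
  by rewrite sumr_const card_ffun card_bool card_ord -[_ *+ _]mulr_natr mulrAC.
apply: le_trans (_ : (_ : nat)%:R <= _); first by rewrite ler_nat; exact: sP.
rewrite natr_sum; apply: ler_sum => t _.
have d0 : 0 <= delta * n.+1%:R by rewrite mulr_ge0 // (le_trans _ (le t)).
have := le t; rewrite !Ex_unif_card -mulrBl normrM [`|_^-1|]ger0_norm ?invr_ge0 //.
rewrite ler_pdivrMr // => /(le_trans (ler_norm _)) {}le.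
have [/eqP ->|/ltnW BA] := leqP #|[set i | column X i == t]| #|[set i | column W i == t]|.
  by [].
by rewrite natrB.
Qed.

(** With high probability [X] itself is consistent, so some [W] is picked. Its column frequencies
    lie within twice the tolerance of those of [X], whence the divisor [2 * 2 ^ N]. *)
Lemma reconstruct_prob delta X : 0 < delta ->
  9 * (2 ^ N)%N%:R <= m.+1%:R * (delta / (2 * (2 ^ N)%N%:R)) ^+ 2 ->
  Ex (iid (unif R n) m.+1) (fun r => (~~ perm_close delta X
     (reconstruct (delta / (2 * (2 ^ N)%N%:R)) r (read (random_queries r) X)))%:R) <= 1 / 9.
Proof.
set e := delta / _ => d0 le.
have N0 : 0 < (2 ^ N)%N%:R :> R by rewrite ltr0n expn_gt0.
have e0 : 0 < e by rewrite divr_gt0 ?mulr_gt0.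
have cheb := @chebyshev_means R _ (unif R n) m {ffun 'I_N -> bool}
  (fun t i => (column X i == t)%:R) e e0.
apply: le_trans (cheb _ _); first last.
- by rewrite card_ffun card_bool card_ord.
- by move=> t i; case: eqP; rewrite ?lexx ?ler01.
apply: le_Ex => r; rewrite ler_nat.
case: existsP => [_|nodev]; first by case: perm_close.
have {}nodev t : `|Ex (unif R m) (fun l => (column X (r l) == t)%:R)
               - Ex (unif R n) (fun i => (column X i == t)%:R)| <= e.
  by rewrite leNgt; apply/negP => dev; apply: nodev; exists t.
have consE W : consistent e r (read (random_queries r) X) W =
   [forall t, `|Ex (unif R m) (fun l => (column X (r l) == t)%:R)
               - Ex (unif R n) (fun i => (column W i == t)%:R)| <= e].
  apply: eq_forallb => t; congr (`|_ - _| <= _).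
  by apply: eq_Ex => l; rewrite view_column_read.
rewrite /reconstruct; case: pickP => [W|/(_ X)]; last first.
  by rewrite consE; move/forallP: nodev => ->.
rewrite consE => /forallP cW /=.
suff -> : perm_close delta X W by [].
have -> : delta = (e + e) * (2 ^ N)%N%:R.
  by rewrite /e; field; rewrite gt_eqF.
apply: perm_close_columns => t.
by have := nodev t; have := cW t; rewrite !ler_norml; lra.
Qed.

End Reconstruction.

(** * The learner *)

Section Learner.
Variables (R : realType) (n m s u : nat) (delta theta : R).
Local Notation N := (s.+1 + u.+1)%N.
Local Notation tol := (delta / (2 * (2 ^ N)%N%:R)).
Implicit Types (X W : {ffun 'I_N -> cube n.+1}) (D : dist R (cube n.+1)).

Definition first_part X : {ffun 'I_s.+1 -> cube n.+1} := [ffun i => X (lshift u.+1 i)].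
Definition second_part X : {ffun 'I_u.+1 -> cube n.+1} := [ffun i => X (rshift s.+1 i)].

Definition spread X : R := Ex (unif R u) (dist_to R (first_part X) \o second_part X).

Definition learner_output (r : {ffun 'I_m.+1 -> 'I_n.+1}) (v : view n.+1 N) :
    option (dist R (cube n.+1)) :=
  let W := reconstruct tol r v in
  if spread W <= theta then Some (push (unif R u) (second_part W)) else None.

Definition learner : nonadaptive R n.+1 :=
  NonAdaptive (iid (unif R n) m.+1) (@random_queries n m N) learner_output.

Lemma learner_complexity : (query_complexity learner <= N * m.+1)%N.
Proof.
apply/bigmax_leqP => r _.
apply: (@leq_trans (\sum_(i < N) m.+1)); last by rewrite sum_nat_const card_ord.
apply: leq_sum => i _; rewrite ffunE; apply: leq_trans (leq_imset_card _ _) _.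
by rewrite card_ord.
Qed.

Lemma prob_learner D E : prob_output learner D E =
  Ex (iid D N) (fun X => Ex (iid (unif R n) m.+1) (fun r =>
    (E (learner_output r (read (random_queries N r) X)))%:R)).
Proof.
rewrite /prob_output /Ex; under [RHS]eq_bigr do rewrite mulr_sumr.
rewrite [RHS]exchange_big /=; apply: eq_bigr => r _.
rewrite big_mkcond; apply: eq_bigr => X _; case: (E _); rewrite ?mulr0 // mulr1.
by rewrite mulrC [in RHS]ffunE.
Qed.

Lemma prob_learner_cat D E : prob_output learner D E =
  Ex (iid D s.+1) (fun A => Ex (iid D u.+1) (fun B =>
    Ex (iid (unif R n) m.+1) (fun r =>
    (E (learner_output r (read (random_queries N r) (cat_ffun A B))))%:R))).
Proof. by rewrite prob_learner Ex_iid_cat. Qed.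

Lemma first_part_cat (A : {ffun 'I_s.+1 -> cube n.+1}) (B : {ffun 'I_u.+1 -> cube n.+1}) :
  first_part (cat_ffun A B) = A.
Proof. by apply/ffunP => i; rewrite ffunE cat_ffun_l. Qed.

Lemma second_part_cat (A : {ffun 'I_s.+1 -> cube n.+1}) (B : {ffun 'I_u.+1 -> cube n.+1}) :
  second_part (cat_ffun A B) = B.
Proof. by apply/ffunP => i; rewrite ffunE cat_ffun_r. Qed.

Lemma perm_closeP X W : reflect
  (exists g : 'S_n.+1, forall k, dH R (X k) (permute g (W k)) <= delta)
  (perm_close delta X W).
Proof. by apply: (iffP existsP) => -[g gP]; exists g; apply/forallP. Qed.

(** A common permutation preserves [dH], so every pairwise distance moves by at most [2 * delta];
    [spread] is a mean of minima of such distances. *)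
Lemma perm_close_spread X W : perm_close delta X W ->
  `|spread X - spread W| <= 2 * delta.
Proof.
move=> /perm_closeP[g XW].
have tri (x x' y y' : cube n.+1) : dH R x y <= dH R x x' + dH R x' y' + dH R y y'.
  apply: le_trans (dH_triangle _ y' _ _) _; rewrite [dH R y y']dHC lerD2r.
  exact: dH_triangle.
have XW' k l : dH R (X k) (X l) <= dH R (W k) (W l) + 2 * delta.
  have := tri (X k) (permute g (W k)) (X l) (permute g (W l)).
  by rewrite dH_permute; have := XW k; have := XW l; lra.
have WX' k l : dH R (W k) (W l) <= dH R (X k) (X l) + 2 * delta.
  rewrite -(dH_permute _ g (W k)).
  have := tri (permute g (W k)) (X k) (permute g (W l)) (X l).
  by rewrite ![dH R (permute _ _) (X _)]dHC; have := XW k; have := XW l; lra.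
have half (Y Z : {ffun 'I_N -> cube n.+1}) : (forall k l, dH R (Y k) (Y l) <= dH R (Z k) (Z l) + 2 * delta) ->
    spread Y <= spread Z + 2 * delta.
  move=> YZ; rewrite -(Ex_cst (unif R u) (2 * delta)) -ExD.
  apply: le_Ex => k /=; apply: le_trans (dist_to_le _ _ _ (nearest R (first_part Z) (second_part Z k))) _.
  by rewrite /dist_to !ffunE.
by rewrite ler_norml; have := half _ _ XW'; have := half _ _ WX'; lra.
Qed.

Lemma perm_push (g : 'S_n.+1) (T : finType) (mu : dist R T) (h : T -> cube n.+1) :
  push mu (permute g \o h) =1 perm_dist g (push mu h).
Proof.
move=> x; rewrite /= !ffunE; apply: eq_bigl => t /=.
by rewrite (can2_eq (@permuteK _ g) (@permuteVK _ g)).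
Qed.

(** Here [spread X <= theta + 2 * delta]. The transport costs at most [spread X + delta] to reach
    the centres, [delta] for the weights, and [spread X + delta] to reach the reconstructed
    samples. *)
Lemma learner_correct D X W : 0 < delta ->
  representative (first_part X) D delta (second_part X) ->
  perm_close delta X W -> spread W <= theta ->
  exists g : 'S_n.+1,
    dEM D (perm_dist g (push (unif R u) (second_part W))) <= 2 * theta + 7 * delta.
Proof.
move=> d0 rep sim pass; have sp := perm_close_spread sim.
case/perm_closeP: sim => g XW; exists g.
apply: dEM_le_transport; apply: (transportable_eqr (perm_push g _ _)).
apply: transportable_le (representative_transport rep _).
have := representative_dist_to rep d0; rewrite -/(spread X).
set e := Ex D _ => eX.
suff : Ex (unif R u) (fun k => dH R (first_part X (nearest R (first_part X) (second_part X k)))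
     ((permute g \o second_part W) k)) <= spread X + delta.
  move: eX sp; rewrite !ler_norml. lra.
rewrite -(Ex_cst (unif R u) delta) -ExD; apply: le_Ex => k /=.
apply: le_trans (dH_triangle _ (second_part X k) _ _) _.
by rewrite dHC lerD2l !ffunE.
Qed.

Hypothesis delta0 : 0 < delta.
Hypothesis m_large : 9 * (2 ^ N)%N%:R <= m.+1%:R * tol ^+ 2.
Hypothesis u_large : 9 * s.+2%:R <= u.+1%:R * (delta / s.+1%:R) ^+ 2.

(** A bad output needs an unrepresentative second part or a failed reconstruction, each of
    probability at most 1/9. *)
Lemma learner_sound D eps : 2 * theta + 7 * delta <= eps ->
  prob_output learner D (outputs_bad D eps) <= 1 / 3.
Proof.
move=> le_eps; rewrite prob_learner_cat.
rewrite -[leRHS](Ex_cst (iid D s.+1)); apply: le_Ex => A.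
apply: (@le_trans _ _ (Ex (iid D u.+1) (fun B =>
  (~~ representative A D delta B)%:R + 1 / 9))); last first.
  by rewrite ExD Ex_cst; have := representative_prob A D delta0 u_large; lra.
apply: le_Ex => B; set X := cat_ffun A B.
apply: le_trans (_ : Ex _ (fun r => (~~ representative A D delta B)%:R +
   (~~ perm_close delta X (reconstruct tol r (read (random_queries N r) X)))%:R) <= _);
  last by rewrite ExD Ex_cst lerD2l; exact: reconstruct_prob X delta0 m_large.
apply: le_Ex => r; rewrite -natrD ler_nat; case: (boolP (outputs_bad _ _ _)) => //.
rewrite /learner_output; case: ifP => // pass /= /forallP bad.
case: (boolP (representative _ _ _ _)) => //= rep.
case: (boolP (perm_close _ _ _)) => //= sim.
have repX : representative (first_part X) D delta (second_part X).
  by rewrite first_part_cat second_part_cat.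
have [g le] := learner_correct delta0 repX sim pass.
by have := bad g; rewrite ltNge (le_trans le).
Qed.

(** Three failure events of probability at most 1/9 each: the first part is unrepresentative for the
    centres [c], the second for the first part, or the reconstruction fails. *)
Lemma learner_complete D K (c : 'I_K.+1 -> cube n.+1) eps :
  9 * K.+2%:R <= s.+1%:R * (delta / K.+1%:R) ^+ 2 ->
  2 * Ex D (dist_to R c) + 5 * delta <= theta ->
  2 * theta + 7 * delta <= eps ->
  2 / 3 <= prob_output learner D (outputs_good D eps).
Proof.
move=> s_large le_theta le_eps; rewrite prob_learner_cat.
suff : 1 <= 1 / 3 + Ex (iid D s.+1) (fun A => Ex (iid D u.+1) (fun B =>
    Ex (iid (unif R n) m.+1) (fun r => (outputs_good D eps
      (learner_output r (read (random_queries N r) (cat_ffun A B))))%:R))) by lra.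
set good := Ex _ _.
apply: (@le_trans _ _ (Ex (iid D s.+1) (fun A => (~~ representative c D delta A)%:R) + 2 / 9 + good));
  last by have := representative_prob c D delta0 s_large; lra.
rewrite -(Ex_cst (iid D s.+1) (2 / 9)) /good -!ExD -[leLHS](Ex_cst (iid D s.+1)).
apply: le_Ex => A.
apply: (@le_trans _ _ ((~~ representative c D delta A)%:R + 1 / 9 +
    Ex (iid D u.+1) (fun B => (~~ representative A D delta B)%:R) +
    Ex (iid D u.+1) (fun B =>
    Ex (iid (unif R n) m.+1) (fun r => (outputs_good D eps
      (learner_output r (read (random_queries N r) (cat_ffun A B))))%:R))));
  last by have := representative_prob A D delta0 u_large; lra.
rewrite -(Ex_cst (iid D u.+1) ((~~ representative c D delta A)%:R + 1 / 9)).
rewrite -!ExD -[leLHS](Ex_cst (iid D u.+1)); apply: le_Ex => B.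
set X := cat_ffun A B.
apply: (@le_trans _ _ ((~~ representative c D delta A)%:R + (~~ representative A D delta B)%:R +
  Ex (iid (unif R n) m.+1) (fun r => (~~ perm_close delta X
     (reconstruct tol r (read (random_queries N r) X)))%:R) +
    Ex (iid (unif R n) m.+1) (fun r => (outputs_good D eps
      (learner_output r (read (random_queries N r) X)))%:R)));
  last by have := reconstruct_prob X delta0 m_large; lra.
rewrite -(Ex_cst (iid (unif R n) m.+1) ((~~ representative c D delta A)%:R + _)).
rewrite -!ExD -[leLHS](Ex_cst (iid (unif R n) m.+1)); apply: le_Ex => r.
rewrite -!natrD ler1n.
case: (boolP (representative c _ _ _)) => //= repA.
case: (boolP (representative A _ _ _)) => //= repB.
case: (boolP (perm_close _ _ _)) => //= sim.
have repX : representative (first_part X) D delta (second_part X).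
  by rewrite first_part_cat second_part_cat.
have pass : spread (reconstruct tol r (read (random_queries N r) X)) <= theta.
  have meanA := representative_dist_to repA delta0.
  have meanB := representative_dist_to repX delta0.
  have sp := perm_close_spread sim.
  (* Transport [D] to the empirical distribution of [A], whose points are at distance 0 from the
     centres [A]. Beyond this, [spread X] adds [delta] and passing to the reconstruction adds
     [2 * delta], which makes up the [5 * delta] in the threshold. *)
  have : Ex D (dist_to R A) <= 2 * Ex D (dist_to R c) + 2 * delta.
    have near : forall y, 0 < push (unif R s) A y -> dist_to R A y <= 0.
      move=> y; rewrite ffunE => y0.
      have /existsP[k /eqP <-] : [exists k, A k == y].
        apply: contraLR y0 => /existsPn ne; rewrite big1 ?ltxx // => k.
        by rewrite (negPf (ne k)).
      by apply: le_trans (dist_to_le _ _ _ k) _; rewrite dHxx.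
    have := Ex_dist_to_le (representative_transport repA A) near.
    rewrite (eq_Ex (unif R s) (psi := dist_to R c \o A)); last by move=> k /=; rewrite dHC.
    by move: meanA; rewrite ler_norml; lra.
  by move: meanB sp; rewrite -/(spread X) first_part_cat !ler_norml; lra.
rewrite /learner_output pass /outputs_good.
suff -> : [exists g : 'S_n.+1, dEM D (perm_dist g (push (unif R u)
  (second_part (reconstruct tol r (read (random_queries N r) X))))) <= eps] by [].
by apply/existsP; have [g le] := learner_correct delta0 repX sim pass;
  exists g; apply: le_trans le_eps.
Qed.

End Learner.

(** * Choice of parameters *)

Lemma large_sample (R : realType) (a b : R) : 0 < b -> exists m : nat, a <= m.+1%:R * b.
Proof.
move=> b0; exists (Num.bound (a / b)).
rewrite -ler_pdivrMr //; have [h|/ltW h] := lerP 0 (a / b); last exact: le_trans h _.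
by apply: ltW; apply: lt_trans (archi_boundP h) _; rewrite ltr_nat.
Qed.

Definition trivial_algorithm (R : realType) n (D : dist R (cube n)) : nonadaptive R n :=
  NonAdaptive (unif R 0) (fun=> [ffun i : 'I_0 => finset.set0]) (fun _ _ => Some D).

Section MainProof.
Variables (R : realType) (d : nat).

(** The bound [q] is chosen before [n]: net size, both sample sizes and the number of coordinates
    are fixed in turn, none referring to [n]. *)
Lemma learner_exists (alpha beta : R) : 0 < alpha ->
  exists q, forall n, exists A : nonadaptive R n,
    beta < alpha -> 0 < beta ->
    let eps := 17 * (3 * alpha + beta / alpha) in
    [/\ (query_complexity A <= q)%N,
        forall D : dist R (cube n), close_to_VCdim beta d D ->
          2 / 3 <= prob_output A D (outputs_good D eps)
      & forall D : dist R (cube n), prob_output A D (outputs_bad D eps) <= 1 / 3].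
Proof.
move=> a0.
have [K netK] := VCdim_net d a0.
have [s s_large] : exists s : nat, 9 * K.+2%:R <= s.+1%:R * (alpha / K.+1%:R) ^+ 2.
  by apply: large_sample; rewrite exprn_gt0 // divr_gt0.
have [u u_large] : exists u : nat, 9 * s.+2%:R <= u.+1%:R * (alpha / s.+1%:R) ^+ 2.
  by apply: large_sample; rewrite exprn_gt0 // divr_gt0.
pose N := (s.+1 + u.+1)%N.
have [m m_large] : exists m : nat,
    9 * (2 ^ N)%N%:R <= m.+1%:R * (alpha / (2 * (2 ^ N)%N%:R)) ^+ 2.
  by apply: large_sample; rewrite exprn_gt0 // divr_gt0 // mulr_gt0 // ltr0n expn_gt0.
exists (N * m.+1)%N => -[|n].
  (* For [n = 0] all distances are 0, so any fixed output is good. *)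
  pose D0 : dist R (cube 0) := push (unif R 0) (fun=> [ffun=> true]).
  exists (trivial_algorithm D0) => ba b0 eps.
  have eps0 : 0 <= eps.
    by have := divr_ge0 (ltW b0) (ltW a0); rewrite /eps; set x := beta / alpha; lra.
  have zero (D E : dist R (cube 0)) : dEM D E <= 0.
    apply: dEM_le_transport; exists [ffun p => D p.1 * E p.2]; first exact: prod_coupling.
    rewrite /transport_cost big1 // => x _; rewrite big1 // => y _.
    by rewrite /dH invr0 !mulr0.
  split=> [|D _|D].
  - apply/bigmax_leqP => r _; by rewrite big_ord0.
  - rewrite /prob_output (_ : \sum_r _ = \sum_r unif R 0 r * \sum_X iid D 0 X).
      by rewrite -mulr_suml !pmf_sum1; lra.
    apply: eq_bigr => r _; rewrite mulr_sumr.
    apply: eq_big => [X|X _]; last by congr (_ * _); rewrite [in RHS]ffunE.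
    by apply/existsP; exists 1%g; exact: le_trans (zero _ _) eps0.
  - rewrite /prob_output big1; first by lra.
    move=> r _; rewrite big_pred0 // => X; apply/negbTE/negP => /forallP /(_ 1%g).
    by rewrite ltNge (le_trans (zero _ _)).
(* The mean distance of [D] to the net is at most [beta + 2 * alpha], one [alpha] being the net
   radius and one the slack of [transportable_dEM]. Twice this plus [5 * alpha] is the threshold,
   and the final error is [4 * beta + 25 * alpha]. *)
exists (learner n m s u alpha (2 * beta + 9 * alpha)) => ba b0 eps.
have le_eps : 2 * (2 * beta + 9 * alpha) + 7 * alpha <= eps.
  have : 0 <= beta / alpha by rewrite divr_ge0 ?ltW.
  by rewrite /eps; set x := beta / alpha; lra.
split=> [|D [D0 VD0 DD0]|D].
- exact: learner_complexity.
- have [c netc] := netK _ _ VD0.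
  apply: (learner_complete a0 m_large u_large s_large _ le_eps (c := c)).
  have near y : 0 < D0 y -> dist_to R c y <= alpha.
    move=> y0; have [|i le] := netc y; first by rewrite inE.
    exact: le_trans (dist_to_le _ _ _ i) le.
  by have := Ex_dist_to_le (transportable_dEM a0 DD0) near; lra.
- exact: learner_sound.
Qed.

End MainProof.

Theorem theorem5p1 (R : realType) (d : nat) :
  exists (q : R -> R -> nat) (A : forall n : nat, R -> R -> nonadaptive R n),
    forall (n : nat) (alpha beta : R),
      0 < alpha < 1 -> 0 < beta < 1 -> beta < alpha ->
      let eps := 17 * (3 * alpha + beta / alpha) in
      eps < 1 ->
      [/\ (query_complexity (A n alpha beta) <= q alpha beta)%N,
          forall D : dist R (cube n), close_to_VCdim beta d D ->
            2 / 3 <= prob_output (A n alpha beta) D (outputs_good D eps)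
        & forall D : dist R (cube n),
            prob_output (A n alpha beta) D (outputs_bad D eps) <= 1 / 3].
Proof.
(* The sign and order conditions stand inside the existentials, so that a choice function can be
   taken over all pairs; when [p.1 <= 0] any algorithm will do. *)
have h (p : R * R) : exists q, forall n, exists A : nonadaptive R n,
    0 < p.1 -> 0 < p.2 -> p.2 < p.1 ->
    let eps := 17 * (3 * p.1 + p.2 / p.1) in
    [/\ (query_complexity A <= q)%N,
        forall D : dist R (cube n), close_to_VCdim p.2 d D ->
          2 / 3 <= prob_output A D (outputs_good D eps)
      & forall D : dist R (cube n), prob_output A D (outputs_bad D eps) <= 1 / 3].
  have [/(learner_exists d p.2)[q qP]|_] := ltP 0 p.1.
    by exists q => n; have [A AP] := qP n; exists A => _ p2 p12; exact: AP.
  by exists 0%N => n; exists (trivial_algorithm (push (unif R 0) (fun=> [ffun=> true]))).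
have [q {}h] := choice h.
exists (fun a b => q (a, b)), (fun n a b => sval (cid (h (a, b) n))).
move=> n a b /andP[a0 _] /andP[b0 _] ba eps _.
exact: svalP (cid (h (a, b) n)) a0 b0 ba.
Qed.
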